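(* Let $G$ be an extraspecial $2$-group of order $2^{2n+1}$ with center $Z=\{1,z\}$, let $S\subseteq G\setminus\{1\}$ be an admissible connecting set with associated integers $\ell$ and $e_y$, $y\in(\mathbb{Z}/2\mathbb{Z})^{2n}$ (see context), and let $X=\mathrm{Cay}(G,S)$. Put $\alpha=\nu_2\big(\gcd(\ell-e_y : y\in(\mathbb{Z}/2\mathbb{Z})^{2n})\big)$, let $$g=\begin{cases}\min(2^{\nu_2(2\ell+2)},2^{\alpha+2}) & \text{if } z\in S,\\ \min(2^{\nu_2(2\ell)},2^{\alpha+2}) & \text{if } z\notin S,\end{cases}$$ and define $h$ by $hg=2^{\alpha+2}$. If $z\in S$ then: (a) $\alpha+1\le\nu_2(\ell+1)$ if and only if $X$ admits neither perfect state transfer nor fractional revival. (b) $\alpha\ge\nu_2(\ell+1)$ if and only if $X$ admits perfect state transfer. When $\alpha=\nu_2(\ell+1)$, $X$ admits perfect state transfer but no other form of fractional revival. (c) $\alpha\ge\nu_2(\ell+1)+1$ if and only if $X$ admits fractional revival that is different from perfect state transfer. In this case $\frac{2\pi}{hg}$ is the minimum time when fractional revival occurs in $X$, and $X$ admits balanced fractional revival at time $\frac{\pi}{2g}$. If $z\notin S$ then: (i) $\alpha+1\le\nu_2(\ell)$ if and only if $X$ admits neither perfect state transfer nor fractional revival. (ii) $\alpha\ge\nu_2(\ell)$ if and only if $X$ admits perfect state transfer. When $\alpha=\nu_2(\ell)$, $X$ admits perfect state transfer but no other form of fractional revival. (iii) $\alpha\ge\nu_2(\ell)+1$ if and only if $X$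 admits fractional revival that is different from perfect state transfer. In this case $\frac{2\pi}{hg}$ is the minimum time when fractional revival occurs in $X$, and $X$ admits balanced fractional revival at time $\frac{\pi}{2g}$.
   Context: An extraspecial $2$-group is a finite $2$-group $G$ whose center $Z$ has order $2$ and such that $G/Z\cong(\mathbb{Z}/2\mathbb{Z})^m$ for some $m\ge1$; its order is $2^{2n+1}$ for some $n\ge 1$. Let $z$ be the unique central involution, fix an isomorphism $G/Z\cong(\mathbb{Z}/2\mathbb{Z})^{2n}$, and write $\bar g$ for the image of a group element. Conjugacy classes of noncentral elements are the cosets $K(x)=\{x,xz\}$. Admissible connecting set: $S\subseteq G\setminus\{1\}$ is a union of conjugacy classes of $G$ (hence closed under inverses), $S$ generates $G$, and $S\ne G\setminus\{1\}$. Write $S\setminus\{z\}=K(x_1)\cup\cdots\cup K(x_\ell)$ with distinct size-$2$ conjugacy classes; this defines $\ell$. For $y\in(\mathbb{Z}/2\mathbb{Z})^{2n}$, $e_y$ is the number of $i$ with $y\cdot\bar x_i=0$ in $\mathbb{Z}/2\mathbb{Z}$. $\mathrm{Cay}(G,S)$ has vertex set $G$, with $x,y$ adjacent iff $xy^{-1}\in S$. $\nu_2$ is the $2$-adic valuation. For a graph with adjacency matrix $A$, $U_A(t)=\sum_{k\ge0}\frac{(it)^k}{k!}A^k$. The graph admits fractional revival at time $\tau>0$ if there are distinct vertices $u,v$ and $a,b\in\mathbb{C}$ with $|a|^2+|b|^2=1$, $b\ne0$ and $U_A(\tau)e_u=a e_u+b e_v$. Perfect state transfer is the special case $a=0$ (fractional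 revival different from perfect state transfer means $a\neq 0$). Balanced fractional revival is the case $|a|=|b|=1/\sqrt2$. *)

(* Defs.v *)
From HB Require Import structures.
From mathcomp Require Import all_boot all_order all_algebra all_fingroup all_solvable.
From mathcomp Require Import complex.
From mathcomp Require Import all_classical all_reals all_analysis.

Set Implicit Arguments.
Unset Strict Implicit.
Unset Printing Implicit Defensive.

Import Order.TTheory GRing.Theory Num.Theory.
Import numFieldNormedType.Exports.

Local Open Scope complex_scope.
Local Open Scope ring_scope.

Definition adjacency_mx (R : realType) (T : finType) (e : rel T) :
    'M[R[i]]_#|T| :=
  \matrix_(i, j) (e (enum_val i) (enum_val j))%:R.

(* The limit is taken in the normed space of complex matrices. *)
Definition transition_mx (R : realType) (N : nat) (A : 'M[R[i]]_N) (t : R) :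
    'M[R[i]]_N :=
  limn (series (fun k : nat => ((0 +i* t) ^+ k / k`!%:R) *: A ^+ k)).

Definition vertex_vec (R : realType) (T : finType) (u : T) : 'cV[R[i]]_#|T| :=
  delta_mx (enum_rank u) 0.

Definition revival (R : realType) (T : finType) (e : rel T) (tau : R)
    (u v : T) (a b : R[i]) : Prop :=
  [/\ u != v,
      `|a| ^+ 2 + `|b| ^+ 2 = 1,
      b != 0 &
      transition_mx (adjacency_mx R e) tau *m vertex_vec R u
        = a *: vertex_vec R u + b *: vertex_vec R v].

(* Perfect state transfer (a = 0) counts as fractional revival. *)
Definition fractional_revival_at (R : realType) (T : finType) (e : rel T)
    (tau : R) : Prop :=
  0 < tau /\ exists (u v : T) (a b : R[i]), revival e tau u v a b.

Definition perfect_state_transfer_at (R : realType) (T : finType) (e : rel T)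
    (tau : R) : Prop :=
  0 < tau /\ exists (u v : T) (a b : R[i]), revival e tau u v a b /\ a = 0.

(* Fractional revival different from perfect state transfer. *)
Definition proper_revival_at (R : realType) (T : finType) (e : rel T)
    (tau : R) : Prop :=
  0 < tau /\ exists (u v : T) (a b : R[i]), revival e tau u v a b /\ a != 0.

Definition balanced_revival_at (R : realType) (T : finType) (e : rel T)
    (tau : R) : Prop :=
  0 < tau /\ exists (u v : T) (a b : R[i]),
    [/\ revival e tau u v a b,
        `|a| = (Num.sqrt 2)^-1%:C & `|b| = (Num.sqrt 2)^-1%:C].

Definition admits_FR (R : realType) (T : finType) (e : rel T) : Prop :=
  exists tau : R, fractional_revival_at e tau.

Definition admits_PST (R : realType) (T : finType) (e : rel T) : Prop :=
  exists tau : R, perfect_state_transfer_at e tau.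

Definition admits_proper_FR (R : realType) (T : finType) (e : rel T) : Prop :=
  exists tau : R, proper_revival_at e tau.

Definition min_revival_time (R : realType) (T : finType) (e : rel T)
    (tau : R) : Prop :=
  fractional_revival_at e tau /\
  forall t : R, fractional_revival_at e t -> tau <= t.

Definition cayley (gT : finGroupType) (S : {set gT}) : rel gT :=
  fun x y => (x * y^-1)%g \in S.

Definition admissible (gT : finGroupType) (S : {set gT}) : Prop :=
  [/\ S \subset [set: gT]^#%g,
      exists2 P : {set {set gT}}, P \subset classes [set: gT] & S = finset.cover P,
      <<S>>%g = [set: gT] &
      S != [set: gT]^#%g].

Definition dot (m : nat) (y v : 'rV['F_2]_m) : 'F_2 :=
  \sum_(i < m) y 0 i * v 0 i.

Definition count_orth (m l : nat) (xbar : 'I_l -> 'rV['F_2]_m)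
    (y : 'rV['F_2]_m) : nat :=
  #|[set i : 'I_l | dot y (xbar i) == 0]|.

(* Main.v *)
(* The group algebra element sum(S) is central.  It acts by -[z \in S] on the
   vectors odd under translation by z, where x_i and x_i z cancel, and on the even
   vectors it is diagonalized by the linear characters of G / Z, with eigenvalues
   [z \in S] + 2l - 4(l - e_y).  Hence U(t) is convolution by an explicit function
   on G, constant on the cosets of Z other than Z itself; so revival can only occur
   between u and zu, and it occurs at t iff exp(i theta_y t) does not depend on y
   and differs from exp(-i [z \in S] t).  With D = gcd(l - e_y) and
   L = l + [z \in S] this reads: exp(4iDt) = 1 and exp(2iLt) != 1, perfect state
   transfer being exp(2iLt) = -1.  Fourier inversion on (Z/2)^{2n} shows that D is a
   power of 2, and comparing the valuations of D and L gives everything. *)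
Require Import Defs.
From HB Require Import structures.
From mathcomp Require Import all_boot all_order all_algebra all_fingroup all_solvable.
From mathcomp Require Import complex.
From mathcomp Require Import all_classical all_reals all_analysis.
From mathcomp Require Import ring lra zify.
Import Order.TTheory GRing.Theory Num.Theory.
Import numFieldNormedType.Exports.
Local Open Scope ring_scope.

Set Implicit Arguments.
Unset Strict Implicit.

(** * Complex exponentials on the unit circle and the spectral form of the transition matrix *)

Definition expi (R : realType) (x : R) : R[i] := (cos x +i* sin x)%C.

Lemma expi0 (R : realType) : expi (0 : R) = 1.
Proof. by rewrite /expi cos0 sin0. Qed.

Lemma expiD (R : realType) (x y : R) : expi (x + y) = expi x * expi y.
Proof. by rewrite /expi cosD sinD; simpc; congr (_ +i* _)%C; ring. Qed.

Lemma expiMn (R : realType) (x : R) (k : nat) : expi (x *+ k) = expi x ^+ k.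
Proof.
elim: k => [|k IHk]; first by rewrite mulr0n expi0.
by rewrite mulrS expiD IHk exprS.
Qed.

Lemma expi_neq0 (R : realType) (x : R) : expi x != 0.
Proof.
apply/eqP => x0; have := expiD x (- x).
by rewrite subrr expi0 x0 mul0r => /eqP; rewrite oner_eq0.
Qed.

Lemma expiN (R : realType) (x : R) : expi (- x) = (expi x)^-1.
Proof.
apply: (mulfI (expi_neq0 x)).
by rewrite -expiD subrr expi0 mulfV// expi_neq0.
Qed.

Lemma norm_expi (R : realType) (x : R) : `|expi x| = 1.
Proof. by rewrite normc_def /= cos2Dsin2 sqrtr1. Qed.

Lemma expi_pi (R : realType) : expi (pi : R) = -1.
Proof. by rewrite /expi cospi sinpi; simpc. Qed.

Lemma expi_2pi (R : realType) : expi (2 * pi : R) = 1.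
Proof. by rewrite mulr_natl expiMn expi_pi sqrrN expr1n. Qed.

(** For [0 < x < 2 * pi] the half-angle sine is positive, so cos x = 1 - 2 sin(x/2)^2 < 1. This
    gives the lower bound on revival times. *)
Lemma expi_eq1_ge (R : realType) (x : R) : 0 < x -> expi x = 1 -> 2 * pi <= x.
Proof.
move=> x0 [cx _]; rewrite leNgt; apply/negP => xpi.
have : 0 < sin (x / 2) by apply: sin_gt0_pi; apply/andP; split; lra.
have h : cos x = (1 - sin (x / 2) ^+ 2) *+ 2 - 1.
  by rewrite -cos2sin2 -cos_mulr2n -(mulr_natr (x / 2)) divfK ?pnatr_eq0.
move=> s0; have : 0 < sin (x / 2) ^+ 2 by rewrite exprn_gt0.
by rewrite mulr2n cx in h; lra.
Qed.

Lemma cvg_real_complex (R : realType) (u : nat -> R) (a : R) :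
  (u @ \oo --> a)%classic -> ((fun k => (u k)%:C%C : R[i]^o) @ \oo --> (a%:C%C : R[i]^o))%classic.
Proof.
move=> ua; apply/cvgrPdist_lt => e e0.
have e_re : e = ((complex.Re e)%:C)%C by rewrite RRe_real// realE ltW.
move/cvgrPdist_lt : ua => /(_ (complex.Re e)).
have -> : 0 < complex.Re e by move: e0; rewrite [X in _ < X -> _]e_re ltcR.
move=> /(_ isT); apply: filterS => k hk.
by rewrite e_re -rmorphB normc_def /= expr0n /= addr0 sqrtr_sqr ltcR.
Qed.

Lemma expi_series (R : realType) (x : R) :
  (series (fun k => (0 +i* x)%C ^+ k / k`!%:R : R[i]^o) @ \oo --> (expi x : R[i]^o))%classic.
Proof.
have -> : expi x = ((cos x)%:C + 'i%C * (sin x)%:C)%C by exact: complexE.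
have -> : series (fun k => (0 +i* x)%C ^+ k / k`!%:R) =
  (fun n => (series (cos_coeff x) n)%:C + 'i%C * (series (sin_coeff x) n)%:C)%C.
  apply/funext => n; rewrite /series /= !rmorph_sum mulr_sumr -big_split /=.
  apply: eq_bigr => k _.
  have -> : (0 +i* x)%C = 'i%C * (x%:C)%C :> R[i] by simpc.
  (* Splitting i^k by the parity of k, in the shape of the coefficients of the cosine and sine
     series. *)
  have iE : 'i%C ^+ k = ((~~ odd k)%:R * (-1) ^+ k./2
     + 'i%C * ((odd k)%:R * (-1) ^+ k.-1./2)) :> R[i].
    rewrite -[in LHS](odd_double_half k) exprD -muln2 mulnC exprM sqr_i.
    case: (odd k) (odd_double_half k) => /= hk.
      rewrite mul0r add0r mul1r expr1; congr (_ * _ ^+ _).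
      by rewrite -[in RHS]hk add1n /= doubleK.
    by rewrite ?expr0 !mul0r mulr0 addr0 !mul1r.
  rewrite exprMn iE !rmorphM !rmorphV ?unitfE ?pnatr_eq0 -?lt0n ?fact_gt0//.
  rewrite !rmorph_nat !rmorphXn !rmorphN1 /=.
  by ring.
apply: cvgD.
  apply: cvg_real_complex; rewrite cos.unlock; exact: is_cvg_series_cos_coeff.
apply: cvgM; first exact: cvg_cst.
apply: cvg_real_complex; rewrite sin.unlock; exact: is_cvg_series_sin_coeff.
Qed.

Lemma cvgr_sum (K : numFieldType) (V : normedModType K) (I : finType)
    (f : I -> nat -> V) (a : I -> V) :
  (forall i, f i @ \oo --> a i)%classic ->
  ((fun n => \sum_i f i n) @ \oo --> \sum_i a i)%classic.
Proof.
move=> fa.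
have -> : (fun n => \sum_i f i n) = \sum_i f i by apply/funext => n; rewrite fct_sumE.
elim/big_ind2 : _ => [|x1 x2 y1 y2 h1 h2|i _]; [exact: cvg_cst|exact: cvgD|exact: fa].
Qed.

(** Multiplying the decomposition of the identity by [A ^+ k] scales each [E i] by the k-th power of
    its eigenvalue, so the matrix series becomes a finite sum of scalar exponential series. *)
Lemma transition_mx_spectral (R : realType) (N : nat) (I : finType)
    (A : 'M[R[i]]_N) (th : I -> R) (E : I -> 'M[R[i]]_N) (t : R) :
  1%:M = \sum_i E i -> (forall i, A *m E i = ((th i)%:C)%C *: E i) ->
  transition_mx A t = \sum_i expi (th i * t) *: E i.
Proof.
move=> id1 AE; apply: norm_cvg_lim.
have powE k : A ^+ k = \sum_i ((th i)%:C)%C ^+ k *: E i.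
  elim: k => [|k IHk].
    by rewrite expr0 [LHS]id1; apply: eq_bigr => i _; rewrite scale1r.
  rewrite exprS IHk mulr_sumr; apply: eq_bigr => i _.
  by rewrite [LHS](_ : _ = A *m (((th i)%:C)%C ^+ k *: E i))// -scalemxAr AE scalerA exprSr.
have -> : series (fun k : nat => ((0 +i* t)%C ^+ k / k`!%:R) *: A ^+ k) =
   (fun n => \sum_i series (fun k => (0 +i* (th i * t))%C ^+ k / k`!%:R) n *: E i).
  apply/funext => n; rewrite /series /=.
  under eq_bigr do rewrite powE scaler_sumr.
  rewrite exchange_big /=; apply: eq_bigr => i _; rewrite scaler_suml.
  apply: eq_bigr => k _; rewrite scalerA; congr (_ *: _).
  have -> : (0 +i* (th i * t))%C = ((th i)%:C * (0 +i* t))%C :> R[i].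
    by simpc.
  by rewrite exprMn; ring.
apply: (@cvgr_sum _ 'M[R[i]]_N) => i.
exact: (@cvgZr_tmp R[i] 'M[R[i]]_N nat _ _ _ _ (E i) (@expi_series R (th i * t))).
Qed.

(** * Characters of (Z/2)^m and convolution matrices *)

Definition sign2 (K : pzRingType) (a : 'F_2) : K := (-1) ^+ a.

Lemma F2_cases (a : 'F_2) : a = 0 \/ a = 1.
Proof. by case: a => [[|[|]]] //= h; [left|right]; apply: val_inj. Qed.

Lemma sign2_0 (K : pzRingType) : sign2 K 0 = 1.
Proof. exact: expr0. Qed.

Lemma sign2_1 (K : pzRingType) : sign2 K 1 = -1.
Proof. exact: expr1. Qed.

Lemma sign2D (K : pzRingType) (a b : 'F_2) : sign2 K (a + b) = sign2 K a * sign2 K b.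
Proof.
have F11 : 1 + 1 = 0 :> 'F_2 by apply: val_inj.
case: (F2_cases a) => ->; case: (F2_cases b) => ->;
  by rewrite ?F11 ?addr0 ?add0r ?sign2_0 ?sign2_1 ?mulr1 ?mul1r ?mulrNN ?mulr1.
Qed.

Lemma addrr_F2 (m : nat) (v : 'rV['F_2]_m) : v + v = 0.
Proof.
apply/rowP => i; rewrite !mxE.
by case: (F2_cases (v 0 i)) => ->; [rewrite addr0|apply: val_inj].
Qed.

Lemma oppr_F2 (m : nat) (v : 'rV['F_2]_m) : - v = v.
Proof. by apply/eqP; rewrite eq_sym -addr_eq0 addrr_F2. Qed.

Lemma dotC (m : nat) (y v : 'rV['F_2]_m) : dot y v = dot v y.
Proof. by apply: eq_bigr => i _; rewrite mulrC. Qed.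

Lemma dotDr (m : nat) (y v w : 'rV['F_2]_m) : dot y (v + w) = dot y v + dot y w.
Proof. by rewrite -big_split; apply: eq_bigr => i _; rewrite mxE mulrDr. Qed.

Lemma dot0r (m : nat) (y : 'rV['F_2]_m) : dot y 0 = 0.
Proof. by apply: big1 => i _; rewrite mxE mulr0. Qed.

(** If some coordinate of [v] is 1, translating y by the matching basis vector flips every sign, so
    the sum equals its own opposite. *)
Lemma sum_sign2_dot (K : numDomainType) (m : nat) (v : 'rV['F_2]_m) :
  \sum_y sign2 K (dot y v) = if v == 0 then 2 ^+ m else 0.
Proof.
case: eqP => [->|/eqP /rV0Pn[i vi]].
  under eq_bigr do rewrite dot0r sign2_0.
  by rewrite sumr_const card_mx card_Fp// mul1n natrX.
have v1 : dot (delta_mx 0 i) v = 1.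
  rewrite /dot (bigD1 i)//= big1 => [|j ji]; last by rewrite mxE eqxx (negPf ji) mul0r.
  by rewrite mxE !eqxx mul1r addr0; case: (F2_cases (v 0 i)) vi => ->; rewrite ?eqxx.
set s := LHS; suff : s = - s by move/eqP; rewrite -subr_eq0 opprK -mulr2n mulrn_eq0 => /eqP.
rewrite {1}/s (reindex_inj (addrI (delta_mx 0 i))) -sumrN.
by apply: eq_bigr => y _; rewrite dotC dotDr sign2D dotC v1 sign2_1 mulN1r dotC.
Qed.

Section Convolution.
Variables (K : pzRingType) (gT : finGroupType).
Implicit Types phi psi : gT -> K.

(** The image of the group algebra element with coefficients [phi] under the left regular
    representation. *)
Definition conv_mx phi : 'M[K]_#|gT| :=
  \matrix_(i, j) phi (enum_val i * (enum_val j)^-1)%g.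

Lemma conv_mxM phi psi :
  conv_mx phi *m conv_mx psi = conv_mx (fun g => \sum_h phi h * psi (h^-1 * g)%g).
Proof.
apply/matrixP => i j; rewrite !mxE.
rewrite (reindex (enum_rank : gT -> 'I_#|gT|)) /=; last exact/onW_bij/enum_rank_bij.
rewrite (reindex_inj (h := fun h => (h^-1 * enum_val i)%g)) /=; last first.
  by move=> a b /mulIg/invg_inj.
apply: eq_bigr => h _; rewrite !mxE enum_rankK invMg invgK !mulgA.
by rewrite mulgV mul1g.
Qed.

Lemma conv_mxZ a phi : a *: conv_mx phi = conv_mx (fun g => a * phi g).
Proof. by apply/matrixP => i j; rewrite !mxE. Qed.

Lemma conv_mxD phi psi : conv_mx phi + conv_mx psi = conv_mx (fun g => phi g + psi g).
Proof. by apply/matrixP => i j; rewrite !mxE. Qed.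

Lemma conv_mx_sum (I : finType) (phi : I -> gT -> K) :
  \sum_i conv_mx (phi i) = conv_mx (fun g => \sum_i phi i g).
Proof. by apply/matrixP => a b; rewrite summxE mxE; apply: eq_bigr => i _; rewrite mxE. Qed.

Lemma conv_mx1 : conv_mx (fun g => (g == 1%g)%:R) = 1%:M.
Proof. by apply/matrixP => i j; rewrite !mxE -eq_mulgV1 (inj_eq enum_val_inj). Qed.

Lemma eq_conv_mx phi psi : phi =1 psi -> conv_mx phi = conv_mx psi.
Proof. by move=> e; apply/matrixP => i j; rewrite !mxE e. Qed.

End Convolution.

Lemma adjacency_mx_cayley (R : realType) (gT : finGroupType) (S : {set gT}) :
  adjacency_mx R (cayley S) = conv_mx (fun g => (g \in S)%:R).
Proof. by apply/matrixP => i j; rewrite !mxE. Qed.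

(** * Spectrum and revival for Cayley graphs of central extensions *)

(* [F] is the projection of the group onto its quotient by {1, z}. *)
Section CentralExtension.
Variables (gT : finGroupType) (m : nat) (F : gT -> 'rV['F_2]_m) (z : gT).
Hypothesis FM : forall a b, F (a * b)%g = F a + F b.
Hypothesis Fker : forall a, (F a == 0) = (a == 1%g) || (a == z).
Hypothesis Fsurj : forall v, exists a, F a = v.
Hypothesis z_neq1 : z != 1%g.

Let F1 : F 1%g = 0. Proof. by apply/eqP; rewrite Fker eqxx. Qed.
Let Fz : F z = 0. Proof. by apply/eqP; rewrite Fker eqxx orbT. Qed.

Let FV a : F a^-1%g = F a.
Proof. by apply: (addrI (F a)); rewrite -FM mulgV F1 addrr_F2. Qed.

Let zz : (z * z = 1)%g.
Proof.
have /eqP : F (z * z)%g = 0 by rewrite FM Fz addr0.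
by rewrite Fker => /orP[/eqP//|/eqP zz]; case/eqP: z_neq1; apply: (mulgI z); rewrite mulg1.
Qed.

Let zV : (z^-1 = z)%g. Proof. by apply/eqP; rewrite eq_invg_mul zz. Qed.

Let Feq a b : (F a == F b) = (a == b) || (a == b * z)%g.
Proof.
have -> : (F a == F b) = (F (b^-1 * a)%g == 0).
  by rewrite FM FV addrC -[X in _ = (_ + X == 0)]oppr_F2 subr_eq0.
by rewrite Fker !(can2_eq (mulKVg b) (mulKg b)) mulg1.
Qed.

(** A set-theoretic section of [F]; the default 1 is never reached because [F] is onto. *)
Let sec v := odflt 1%g [pick a | F a == v].
Let secK v : F (sec v) = v.
Proof.
rewrite /sec; case: pickP => [a /eqP//|no]; have [a av] := Fsurj v.
by have := no a; rewrite av eqxx.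
Qed.

Let sum_fiber (K : pzRingType) (phi : gT -> K) v :
  \sum_(a | F a == v) phi a = phi (sec v) + phi (sec v * z)%g.
Proof.
rewrite (bigD1 (sec v)) ?secK//= (bigD1 (sec v * z)%g) /=; last first.
  rewrite FM Fz secK addr0 eqxx /= -(inj_eq (mulgI (sec v)^-1%g)).
  by rewrite mulKg mulVg.
rewrite big1 ?addr0// => a /andP[/andP[]]; rewrite -[v in F a == v]secK Feq.
by case: eqP => //= _ ->.
Qed.

Section Spectrum.
Variables (R : realType) (l : nat) (xb : 'I_l -> 'rV['F_2]_m) (eps : bool) (S : {set gT}).
Hypothesis xb_inj : injective xb.
Hypothesis xb_neq0 : forall i, xb i != 0.
Hypothesis SE : forall a, (a \in S) = (eps && (a == z)) || [exists i, F a == xb i].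

Let sum_S (phi : gT -> R[i]) : \sum_a (a \in S)%:R * phi a =
  eps%:R * phi z + \sum_i (phi (sec (xb i)) + phi (sec (xb i) * z)%g).
Proof.
(* The [xb i] are distinct and nonzero, so at most one indicator on the right is nonzero. *)
have SE' a : (a \in S)%:R = eps%:R * (a == z)%:R + \sum_i (F a == xb i)%:R :> R[i].
  have [/existsP[i /eqP ai]|ne] := boolP [exists i, F a == xb i].
    have az : (a == z) = false.
      by apply/negP => /eqP az; have := xb_neq0 i; rewrite -ai az Fz eqxx.
    rewrite SE az andbF mulr0 add0r (bigD1 i)//= ai eqxx big1.
      by rewrite addr0; have -> : [exists j, xb i == xb j] by apply/existsP; exists i.
    by move=> j ji; rewrite (inj_eq xb_inj) eq_sym (negPf ji).
  rewrite SE (negPf ne) orbF big1 => [|i _]; first by rewrite addr0 -natrM mulnb.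
  by apply/eqP; rewrite pnatr_eq0 eqb0; apply: contraNN ne => ai; apply/existsP; exists i.
under eq_bigr do rewrite SE' mulrDl mulr_suml.
rewrite big_split /= exchange_big /=; congr (_ + _).
  rewrite (bigD1 z)//= eqxx mulr1 big1 ?addr0// => a az.
  by rewrite (negPf az) mulr0 mul0r.
apply: eq_bigr => i _; rewrite -sum_fiber [RHS]big_mkcond /=; apply: eq_bigr => a _.
by case: eqP; rewrite ?mul1r ?mul0r.
Qed.

(* Eigenvalue on the linear character indexed by [y]; vectors [v] with
   [z v = - v] have eigenvalue [- eps]. *)
Definition plus_eigenvalue (y : 'rV['F_2]_m) : R :=
  eps%:R + 2 * l%:R - 4 * (l - count_orth xb y)%:R.

(** The [chi y] are the linear characters of G trivial on [z]; convolution by half of [psi] projects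
    onto the functions that are odd under translation by [z]. *)
Let chi (y : 'rV['F_2]_m) (a : gT) : R[i] := sign2 R[i] (dot y (F a)).
Let psi (a : gT) : R[i] := (a == 1%g)%:R - (a == z)%:R.

Let chiM y a b : chi y (a * b)%g = chi y a * chi y b.
Proof. by rewrite /chi FM dotDr sign2D. Qed.

(** Of the l signs, e_y equal 1 and the other l - e_y equal -1. *)
Lemma sum_sign2_xb (K : comNzRingType) (y : 'rV['F_2]_m) :
  \sum_i sign2 K (dot y (xb i)) = l%:R - 2 * (l - count_orth xb y)%:R.
Proof.
have le : (count_orth xb y <= l)%N.
  by rewrite -[leqRHS]card_ord max_card.
rewrite natrB// (_ : l%:R - _ = (count_orth xb y)%:R *+ 2 - l%:R); last by ring.
have -> : l%:R = \sum_(i < l) 1 :> K by rewrite sumr_const card_ord.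
rewrite /count_orth -sum1dep_card natr_sum -sumrMnl [X in _ = X - _]big_mkcond -sumrB /=.
apply: eq_bigr => i _.
case: (F2_cases (dot y (xb i))) => ->; rewrite ?eqxx ?sign2_0 ?sign2_1 ?oner_eq0.
  by rewrite mulr2n addrK.
by rewrite sub0r.
Qed.

Let adjacency_chi y : adjacency_mx R (cayley S) *m conv_mx (chi y)
  = ((plus_eigenvalue y)%:C)%C *: conv_mx (chi y).
Proof.
rewrite adjacency_mx_cayley conv_mxM conv_mxZ; apply: eq_conv_mx => a.
rewrite sum_S.
have chiz : chi y z = 1 by rewrite /chi Fz dot0r sign2_0.
have chiV b : chi y b^-1%g = chi y b by rewrite /chi FV.
under eq_bigr do rewrite !chiM !chiV !chiM chiz mulr1 -mulr2n -mulr_natl mulrA.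
rewrite chiM chiV chiz mul1r -mulr_suml -mulr_sumr -mulrDl; congr (_ * _).
under eq_bigr do rewrite /chi secK.
rewrite sum_sign2_xb /plus_eigenvalue !(rmorphB, rmorphD, rmorphM, rmorph_nat) /=.
by ring.
Qed.

Let adjacency_psi : adjacency_mx R (cayley S) *m conv_mx psi
  = ((- eps%:R)%:C)%C *: conv_mx psi.
Proof.
rewrite adjacency_mx_cayley conv_mxM conv_mxZ; apply: eq_conv_mx => a.
have psiz b : psi (z * b)%g = - psi b.
  rewrite /psi opprB; congr (_%:R - _%:R).
    by rewrite -(inj_eq (mulgI z)) mulgA zz mul1g mulg1.
  by rewrite -[X in _ == X]mulg1 (inj_eq (mulgI z)).
rewrite sum_S big1 => [|i _]; last by rewrite invMg zV -mulgA psiz subrr.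
by rewrite zV psiz addr0 mulrN rmorphN rmorph_nat mulNr.
Qed.

Definition minus_phase (t : R) : R[i] := expi (- eps%:R * t).
Definition plus_phase (y : 'rV['F_2]_m) (t : R) : R[i] := expi (plus_eigenvalue y * t).

(** The function whose convolution is U(t). The weights 1/2 and 1/|G| = 2^-(m+1) are those with
    which [psi] and the characters add up to the identity. *)
Let kernel (t : R) (a : gT) : R[i] :=
  minus_phase t * (2^-1 * psi a)
  + \sum_y plus_phase y t * ((2 ^+ m.+1)^-1 * chi y a).

Let sum_chi a : \sum_y chi y a = if F a == 0 then 2 ^+ m else 0.
Proof. exact: sum_sign2_dot. Qed.

Let transition_conv t : transition_mx (adjacency_mx R (cayley S)) t = conv_mx (kernel t).
Proof.
pose E (i : option 'rV['F_2]_m) : 'M[R[i]]_#|gT| :=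
  if i is Some y then (2 ^+ m.+1)^-1 *: conv_mx (chi y) else 2^-1 *: conv_mx psi.
pose th (i : option 'rV['F_2]_m) : R :=
  if i is Some y then plus_eigenvalue y else - eps%:R.
have two0 : 2 != 0 :> R[i] by rewrite pnatr_eq0.
have sumO (V : nmodType) (G : option 'rV['F_2]_m -> V) :
    \sum_i G i = G None + \sum_y G (Some y).
  rewrite (bigD1 None)//=; congr (_ + _).
  rewrite (reindex_omap Some id)/=; last by case.
  by apply: eq_bigl => y; rewrite eqxx.
rewrite (@transition_mx_spectral _ _ _ _ th E).
- rewrite sumO /= conv_mxZ conv_mxZ.
  under eq_bigr do rewrite !conv_mxZ.
  by rewrite conv_mx_sum conv_mxD.
- rewrite sumO /= conv_mxZ.
  under eq_bigr do rewrite conv_mxZ.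
  rewrite conv_mx_sum conv_mxD -conv_mx1; apply: eq_conv_mx => a.
  (* The odd and even parts take the values 1/2, 1/2 at 1, then -1/2, 1/2 at [z], and both vanish
     elsewhere. *)
  rewrite -mulr_sumr sum_chi Fker /psi.
  have [->|a1] := eqVneq a 1%g; first last.
    case: eqVneq => [_|_] /=; last by rewrite subrr mulr0 add0r mulr0.
    by rewrite exprS; field; rewrite ?expf_neq0 ?two0.
  by rewrite eq_sym (negPf z_neq1) /= exprS; field; rewrite ?expf_neq0 ?two0.
- case=> [y|] /=; rewrite -scalemxAr ?adjacency_chi ?adjacency_psi;
  by rewrite !scalerA mulrC.
Qed.

(** Column [u] of a convolution matrix is the kernel translated by [u]. *)
Let revival_kernel t u v (a b : R[i]) :
  (transition_mx (adjacency_mx R (cayley S)) t *m vertex_vec R u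
     = a *: vertex_vec R u + b *: vertex_vec R v) <->
  (forall g, kernel t g = a * (g == 1%g)%:R + b * (g == (v * u^-1)%g)%:R).
Proof.
rewrite transition_conv /vertex_vec -colE; split.
  move=> /colP h g; have := h (enum_rank (g * u)%g).
  rewrite !mxE !enum_rankK mulgK => ->.
  rewrite !(inj_eq enum_rank_inj) !andbT; congr (_ * _%:R + _ * _%:R).
    by rewrite -[X in _ == X]mul1g (inj_eq (mulIg u)).
  by congr nat_of_bool; rewrite -[RHS](inj_eq (mulIg u)) mulgKV.
move=> h; apply/colP => i; rewrite !mxE h enum_rankK -eq_mulgV1 (inj_eq (mulIg _)).
by rewrite !eqxx !andbT !(can2_eq enum_valK enum_rankK).
Qed.

(* The kernel of the evolution operator is [a] at 1, [b] at [v u^-1] and 0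
   elsewhere, but it agrees on [c] and [c z] for noncentral [c]: hence [v = z u].
   Fourier inversion then recovers the phases. *)
Lemma revival_plus_phase t u v (a b : R[i]) : u != v -> b != 0 ->
  transition_mx (adjacency_mx R (cayley S)) t *m vertex_vec R u
     = a *: vertex_vec R u + b *: vertex_vec R v ->
  (forall y, plus_phase y t = a + b) /\ minus_phase t = a - b.
Proof.
move=> uv b0 /revival_kernel.
move: (v * u^-1)%g (eq_mulgV1 v u) => w; rewrite eq_sym (negPf uv) => /esym w1 h.
(* Off the center [psi] vanishes, and the characters do not see [z]. *)
have pz c : F c != 0 -> kernel t (c * z)%g = kernel t c.
  move=> Fc; rewrite /kernel; congr (_ * (_ * _) + _).
    rewrite /psi.
    have [-> ->] : (c == 1%g) = false /\ (c == z) = false.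
      by move: Fc; rewrite Fker negb_or => /andP[/negPf -> /negPf ->].
    have : F (c * z)%g != 0 by rewrite FM Fz addr0.
    by rewrite Fker negb_or => /andP[/negPf -> /negPf ->].
  by apply: eq_bigr => y _; rewrite chiM /chi Fz dot0r sign2_0 mulr1.
have wz : w = z.
  apply/eqP; apply: contraT => wz; case/eqP: b0.
  have Fw : F w != 0 by rewrite Fker w1 (negPf wz).
  have Fwz : F (w * z)%g != 0 by rewrite FM Fz addr0.
  move: Fwz; rewrite Fker negb_or => /andP[/negPf wz1 _].
  have := pz _ Fw; rewrite !h wz1 w1 eqxx mulr0 mulr1 !add0r => <-.
  by rewrite -[X in _ == X]mulg1 (inj_eq (mulgI w)) (negPf z_neq1) mulr0.
rewrite {w w1}wz in h.
have z1 := negPf z_neq1; have z1' : (1%g == z) = false by rewrite eq_sym.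
have two0 : 2 != 0 :> R[i] by rewrite pnatr_eq0.
(* The Fourier transform of the even phases. It will turn out to be supported at 0, which forces the
   phases to be constant. *)
pose C v := \sum_y plus_phase y t * sign2 R[i] (dot y v).
have kernelE g : kernel t g = minus_phase t * (2^-1 * psi g) + (2 ^+ m.+1)^-1 * C (F g).
  by rewrite /kernel /C mulr_sumr; congr (_ + _); apply: eq_bigr => y _; rewrite /chi; ring.
have h1 := h 1%g; have hz := h z.
have psi1 : psi 1%g = 1 by rewrite /psi eqxx z1' subr0.
have psiz : psi z = -1 by rewrite /psi eqxx z1 sub0r.
rewrite !kernelE psi1 psiz F1 Fz ?eqxx ?z1 ?z1' ?mulr0 !mulr1 ?addr0 ?add0r in h1 hz.
have C0 : C 0 = 2 ^+ m * (a + b).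
  by rewrite -h1 -hz exprS; field; rewrite ?expf_neq0 ?two0.
split; last first.
  by rewrite -h1 -hz exprS; field; rewrite ?expf_neq0 ?two0.
have Cv v' : v' != 0 -> C v' = 0.
  move=> v0; have := h (sec v'); rewrite kernelE secK.
  have : F (sec v') != 0 by rewrite secK.
  rewrite Fker negb_or /psi => /andP[/negPf-> /negPf->].
  rewrite subrr !mulr0 addr0 add0r => /eqP.
  by rewrite mulf_eq0 invr_eq0 expf_eq0 /= (negPf two0) => /eqP.
move=> y.
have : \sum_v' sign2 R[i] (dot y v') * C v' = C 0.
  rewrite (bigD1 0)//= dot0r sign2_0 mul1r big1 ?addr0// => v' v0.
  by rewrite Cv// mulr0.
rewrite {1}/C; under eq_bigr do rewrite mulr_sumr.
rewrite exchange_big /=.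
have inner y' : \sum_v' sign2 R[i] (dot y v') * (plus_phase y' t * sign2 R[i] (dot y' v'))
    = plus_phase y' t * (if y' == y then 2 ^+ m else 0).
  rewrite -[y in y' == y]oppr_F2 -addr_eq0 -sum_sign2_dot mulr_sumr.
  by apply: eq_bigr => v' _; rewrite mulrCA -sign2D addrC dotDr !(dotC v').
under eq_bigr do rewrite inner.
rewrite (bigD1 y)//= eqxx big1 => [|y' /negPf->]; last by rewrite mulr0.
by rewrite addr0 C0 mulrC => /(mulfI _); apply; rewrite expf_neq0.
Qed.

(** With one common phase p on the even part and q on the odd part, U(t) is p(1 + z)/2 + q(1 -
    z)/2. *)
Lemma plus_phase_revival t u : (forall y, plus_phase y t = plus_phase 0 t) ->
  transition_mx (adjacency_mx R (cayley S)) t *m vertex_vec R u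
     = ((plus_phase 0 t + minus_phase t) / 2) *: vertex_vec R u
       + ((plus_phase 0 t - minus_phase t) / 2) *: vertex_vec R (z * u)%g.
Proof.
move=> ph; apply/revival_kernel => g; rewrite mulgK /kernel.
under eq_bigr do rewrite ph.
rewrite -!mulr_sumr sum_chi Fker /psi.
have two0 : 2 != 0 :> R[i] by rewrite pnatr_eq0.
have e2 : (2 ^+ m.+1)^-1 * 2 ^+ m = 2^-1 :> R[i].
  by rewrite exprS; field; rewrite ?expf_neq0 ?two0.
have [->|g1] := eqVneq g 1%g; last case: eqVneq => _ /=.
- by rewrite eq_sym (negPf z_neq1) /= e2; ring.
- by rewrite e2; ring.
- by ring.
Qed.

Lemma plus_phaseE y t : plus_phase y t =
  expi ((eps%:R + 2 * l%:R) * t) * expi (- (4 * (l - count_orth xb y)%:R * t)).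
Proof. by rewrite -expiD; congr expi; rewrite /plus_eigenvalue; ring. Qed.

Lemma plus_phase0 t : plus_phase 0 t = expi ((eps%:R + 2 * l%:R) * t).
Proof.
rewrite plus_phaseE; have -> : count_orth xb 0 = l.
  rewrite /count_orth (_ : [set i | _] = [set: 'I_l]%SET) ?cardsT ?card_ord//.
  by apply/setP => i; rewrite !inE dotC dot0r eqxx.
by rewrite subnn mulr0 mul0r oppr0 expi0 mulr1.
Qed.

Lemma plus_phase_const y t :
  plus_phase y t = plus_phase 0 t <-> expi (4 * (l - count_orth xb y)%:R * t) = 1.
Proof.
rewrite plus_phase0 plus_phaseE; split=> [h|h].
  have := expiN (4 * (l - count_orth xb y)%:R * t).
  move/(mulfI (expi_neq0 _)): (etrans h (esym (mulr1 _))) => -> /esym/eqP.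
  by rewrite invr_eq1 => /eqP.
by rewrite expiN h invr1 mulr1.
Qed.

Definition orth_gcd : nat :=
  \big[gcdn/0%N]_(y : 'rV['F_2]_m) (l - count_orth xb y)%N.

(** The integers d with exp(4idt) = 1 are closed under multiples and, by Bezout, under gcd. *)
Lemma plus_phase_gcd t :
  (forall y, plus_phase y t = plus_phase 0 t) <-> expi (4 * orth_gcd%:R * t) = 1.
Proof.
split=> [h|h y]; last first.
  apply/plus_phase_const; have /dvdnP[k ->] : (orth_gcd %| l - count_orth xb y)%N.
    by rewrite /orth_gcd (bigD1 y)//= dvdn_gcdl.
  by rewrite natrM (_ : _ * t = (4 * orth_gcd%:R * t) *+ k) ?expiMn ?h ?expr1n//; ring.
rewrite /orth_gcd; elim/big_ind : _ => [|a b ha hb|y _].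
- by rewrite mulr0 mul0r expi0.
- have [->|b0] := posnP b; first by rewrite gcdn0.
  have [->|a0] := posnP a; first by rewrite gcd0n.
  case: (egcdnP b a0) => p q pq _.
  have e : 4 * (p * a)%:R * t = 4 * (q * b)%:R * t + 4 * (gcdn a b)%:R * t.
    by rewrite pq natrD; ring.
  have := congr1 (@expi R) e; rewrite expiD.
  have -> c d : 4 * (c * d)%:R * t = (4 * d%:R * t) *+ c by rewrite natrM; ring.
  have -> c d : 4 * (c * d)%:R * t = (4 * d%:R * t) *+ c by rewrite natrM; ring.
  by rewrite !expiMn ha hb !expr1n mul1r.
- exact/plus_phase_const.
Qed.

(* The Fourier transform of [y |-> l - e_y] at [xb i] is [- 2 ^ (m - 1)]. *)
Lemma orth_gcd_pow2 : (0 < l)%N -> orth_gcd = (2 ^ logn 2 orth_gcd)%N.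
Proof.
move=> l0; have : (orth_gcd %| 2 ^ m)%N.
  pose v := xb (Ordinal l0).
  pose q y := ((l - count_orth xb y) %/ orth_gcd)%N.
  have qE y : (l - count_orth xb y)%N = (q y * orth_gcd)%N.
    by rewrite divnK// /orth_gcd (bigD1 y)//= dvdn_gcdl.
  (* The Fourier coefficient at [v], doubled to stay within the integers: the constant l contributes
     0, and among the [xb i] only the one equal to [v] contributes. *)
  have e : 2 * orth_gcd%:R * \sum_y sign2 int (dot y v) * (q y)%:R = - 2 ^+ m.
    rewrite mulr_sumr.
    transitivity (\sum_y sign2 int (dot y v) * (l%:R - \sum_i sign2 int (dot y (xb i)))).
      by apply: eq_bigr => y _; rewrite sum_sign2_xb qE natrM; ring.
    under eq_bigr do rewrite mulrBr.
    rewrite sumrB -mulr_suml sum_sign2_dot (negPf (xb_neq0 _)) mul0r sub0r; congr (- _).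
    under eq_bigr do rewrite mulr_sumr.
    rewrite exchange_big (bigD1 (Ordinal l0))//= [X in _ + X]big1 ?addr0 => [|i il].
      by under eq_bigr do rewrite -sign2D -dotDr addrr_F2; rewrite sum_sign2_dot eqxx.
    under eq_bigr do rewrite -sign2D -dotDr.
    rewrite sum_sign2_dot -[xb i]oppr_F2 subr_eq0 (inj_eq xb_inj) [_ == i]eq_sym.
    by rewrite (negPf il).
  have : (orth_gcd%:Z %| (2 ^ m)%N%:Z)%Z.
    apply/dvdzP; exists (- (2 * \sum_y sign2 int (dot y v) * (q y)%:R)).
    rewrite mulNr; apply: oppr_inj; rewrite opprK -[in LHS]natz natrX -e; ring.
  by rewrite dvdzE.
by case/dvdn_pfactor => // k _ ->; rewrite pfactorK.
Qed.

(** * Revival criteria in terms of two phases *)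

Let L := (l + eps)%N.

Let N1_neq1 : -1 <> 1 :> R[i].
Proof. by move=> /eqP; rewrite eq_sym -addr_eq0 -mulr2n mulrn_eq0 oner_eq0. Qed.

(** The eigenvalue eps + 2l of the trivial character and the odd eigenvalue -eps differ by 2L. *)
Let plus_minus_phase t : plus_phase 0 t = minus_phase t * expi (2 * L%:R * t).
Proof. by rewrite plus_phase0 -expiD; congr expi; rewrite /L natrD; ring. Qed.

(** The even phase is a + b and the odd one a - b, so a + b = (a - b)w with w = exp(2iLt). Hence w =
    1 would give b = 0, and w = -1 is the case a = 0. *)
Lemma revival_phases (t : R) u v (a b : R[i]) : revival (cayley S) t u v a b ->
  [/\ expi (4 * orth_gcd%:R * t) = 1, expi (2 * L%:R * t) <> 1 &
      a = 0 <-> expi (2 * L%:R * t) = -1].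
Proof.
move=> [uv _ b0 /(revival_plus_phase uv b0)[plus_ab minus_ab]].
have plus0 := plus_minus_phase t; rewrite plus_ab minus_ab in plus0.
have ab0 : a - b != 0 by rewrite -minus_ab expi_neq0.
split.
- by apply/plus_phase_gcd => y; rewrite !plus_ab.
- move=> w1; move: plus0; rewrite w1 mulr1 => /addrI/eqP.
  by rewrite -addr_eq0 -mulr2n mulrn_eq0 (negPf b0).
- split=> [a0|wN1].
    by apply: (mulfI ab0); rewrite -plus0 a0 add0r sub0r mulrN1 opprK.
  move: plus0; rewrite wN1 mulrN1 opprB addrC => /addrI/eqP.
  by rewrite -addr_eq0 -mulr2n mulrn_eq0 => /eqP.
Qed.

Lemma phases_revival t : expi (4 * orth_gcd%:R * t) = 1 -> expi (2 * L%:R * t) <> 1 ->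
  revival (cayley S) t 1%g z (minus_phase t * ((expi (2 * L%:R * t) + 1) / 2))
                             (minus_phase t * ((expi (2 * L%:R * t) - 1) / 2)).
Proof.
move=> /plus_phase_gcd/(plus_phase_revival 1%g); rewrite mulg1 plus_minus_phase.
set w := expi _; set q := minus_phase t => tr w1; split.
- by rewrite eq_sym.
- rewrite !normrM norm_expi !mul1r !normfV !normr_nat.
  rewrite !exprMn -mulrDl !normCK !(rmorphB, rmorphD, rmorph1).
  have ww : w * w^* = 1 by rewrite -normCK norm_expi expr1n.
  (* The parallelogram law |w + 1|^2 + |w - 1|^2 = 2(|w|^2 + 1), which equals 4 on the unit
     circle. *)
  rewrite (_ : _ + _ = 2 * (w * w^* + 1)); last by ring.
  by rewrite ww; field.
- by rewrite !mulf_neq0 ?invr_eq0 ?subr_eq0 ?expi_neq0 ?pnatr_eq0//; exact/eqP.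
- by rewrite tr; congr (_ *: _ + _ *: _); ring.
Qed.

Lemma fractional_revival_atE (t : R) : fractional_revival_at (cayley S) t <->
  [/\ 0 < t, expi (4 * orth_gcd%:R * t) = 1 & expi (2 * L%:R * t) <> 1].
Proof.
split=> [[t0 [u [v [a [b /revival_phases[]]]]]]//|[t0 w4 w1]].
by split=> //; do 4 eexists; apply: phases_revival.
Qed.

Lemma perfect_state_transfer_atE (t : R) : perfect_state_transfer_at (cayley S) t <->
  [/\ 0 < t, expi (4 * orth_gcd%:R * t) = 1 & expi (2 * L%:R * t) = -1].
Proof.
split=> [[t0 [u [v [a [b [/revival_phases[? ? ?] a0]]]]]]|[t0 w4 wN1]].
  by split=> //; tauto.
have w1 : expi (2 * L%:R * t) <> 1 by rewrite wN1.
split=> //; do 4 eexists; split; first exact: phases_revival.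
by rewrite wN1 addNr mul0r mulr0.
Qed.

Lemma proper_revival_atE (t : R) : proper_revival_at (cayley S) t <->
  [/\ 0 < t, expi (4 * orth_gcd%:R * t) = 1, expi (2 * L%:R * t) <> 1 &
      expi (2 * L%:R * t) <> -1].
Proof.
split=> [[t0 [u [v [a [b [/revival_phases[? ? ?] /eqP a0]]]]]]|[t0 w4 w1 wN1]].
  by split=> //; tauto.
split=> //; do 4 eexists; split; first exact: phases_revival.
have w1' : expi (2 * L%:R * t) + 1 != 0 by rewrite addr_eq0; exact/eqP.
by rewrite !mulf_neq0 ?invr_eq0 ?expi_neq0 ?pnatr_eq0.
Qed.

(** A phase w with w^2 = -1 is i or -i, so w + 1 and w - 1 both have modulus sqrt 2. *)
Lemma balanced_revival_at_phases (t : R) : 0 < t ->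
  expi (4 * orth_gcd%:R * t) = 1 -> expi (2 * L%:R * t) ^+ 2 = -1 ->
  balanced_revival_at (cayley S) t.
Proof.
move=> t0 w4 w2.
have w1 : expi (2 * L%:R * t) <> 1 by move=> w1; move: w2; rewrite w1 expr1n => /esym/N1_neq1.
have s2 : (((Num.sqrt 2)^-1 : R)%:C)%C ^+ 2 = 2^-1 :> R[i].
  by rewrite -rmorphXn exprVn sqr_sqrtr ?ler0n// rmorphV ?unitfE ?pnatr_eq0// rmorph_nat.
have half x : x * x^* = 2 ->
    `|minus_phase t * (x / 2)| = (((Num.sqrt 2)^-1 : R)%:C)%C.
  move=> x2; apply/eqP; rewrite -(@eqrXn2 _ 2)//; last by rewrite ler0c invr_ge0 sqrtr_ge0.
  by rewrite s2 !normrM norm_expi mul1r normfV normr_nat exprMn normCK x2; apply/eqP; field.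
have ww := norm_expi (2 * L%:R * t); have rev := phases_revival w4 w1.
set w := expi _ in ww w2 rev.
have w0 : w != 0 by exact: expi_neq0.
have wC : w^* = - w.
  by apply: (mulfI w0); rewrite -normCK ww expr1n mulrN -expr2 w2 opprK.
split=> //; do 4 eexists; split; first exact: rev.
all: rewrite half// !(rmorphB, rmorphD, rmorph1) /= wC.
all: rewrite (_ : _ * _ = 1 - w ^+ 2); last by ring.
all: by rewrite w2; ring.
Qed.

(** * Comparison of the 2-adic valuations [alpha] of the gcd and [nu] of [L] *)

Variables alpha nu k : nat.
Hypothesis gcdE : orth_gcd = (2 ^ alpha)%N.
Hypothesis LE : L = (2 ^ nu * k)%N.
Hypothesis k_odd : odd k.

Let two_pow_gt0 j : 0 < (2 ^ j)%:R :> R. Proof. by rewrite ltr0n expn_gt0. Qed.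

Let expi_gcd j : (j <= alpha + 1)%N -> expi (4 * orth_gcd%:R * (pi / (2 ^ j)%:R : R)) = 1.
Proof.
move=> ja; rewrite gcdE (_ : _ * _ = (2 * pi) *+ 2 ^ (alpha + 1 - j)).
  by rewrite expiMn expi_2pi expr1n.
have e : (2 ^ alpha * 2 = 2 ^ (alpha + 1 - j) * 2 ^ j)%N.
  by rewrite -expnSr -expnD subnK// addn1.
move/(congr1 (fun i => i%:R : R)): e; rewrite !natrM => e.
rewrite -[RHS]mulr_natl; move: e (lt0r_neq0 (two_pow_gt0 j)).
move: (2 ^ alpha)%N%:R (2 ^ j)%N%:R (2 ^ (alpha + 1 - j))%N%:R => A P Q e P0.
apply: (mulIf P0); rewrite mulrA [LHS]mulfVK// (_ : Q * _ * P = Q * P * (2 * pi)); last by ring.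
by rewrite -e; ring.
Qed.

(** At this time the angle is [pi] times the odd number [k]; halving the time gives a square root of
    -1. *)
Let phase_half : expi (2 * L%:R * (pi / (2 ^ (nu + 1))%:R : R)) = -1.
Proof.
rewrite LE (_ : _ * _ = pi *+ k).
  by rewrite expiMn expi_pi -signr_odd k_odd.
by rewrite natrM addn1 expnS natrM -mulr_natl; field; rewrite lt0r_neq0.
Qed.

Let phase_quarter : expi (2 * L%:R * (pi / (2 ^ (nu + 2))%:R : R)) ^+ 2 = -1.
Proof.
rewrite -expiMn -[RHS]phase_half; congr expi.
rewrite addn2 addn1 !expnS !natrM -mulr_natl; field.
by rewrite lt0r_neq0.
Qed.

Lemma PST_valuation : (nu <= alpha)%N -> admits_PST R (cayley S).
Proof.
move=> h; exists (pi / (2 ^ (nu + 1))%:R); apply/perfect_state_transfer_atE.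
by split; rewrite ?divr_gt0 ?pi_gt0// expi_gcd// leq_add2r.
Qed.

(** If [alpha < nu], the angle 2Lt is an integer multiple of 4Dt with D = [orth_gcd], so the first
    phase condition contradicts the second. *)
Lemma FR_valuation : admits_FR R (cayley S) -> (nu <= alpha)%N.
Proof.
move=> [t /fractional_revival_atE[_ w4 w1]]; rewrite leqNgt; apply/negP => h; apply: w1.
rewrite LE (_ : _ * _ = (4 * orth_gcd%:R * t) *+ (2 ^ (nu - alpha.+1) * k)).
  by rewrite expiMn w4 expr1n.
rewrite gcdE -[nu in LHS](subnK h) expnD expnS -[RHS]mulr_natl !natrM.
by move: (2 ^ _)%N%:R (2 ^ _)%N%:R k%:R => A B C; ring.
Qed.

(** If [alpha = nu], then 4Lt is k times 4Dt, so exp(2iLt) squares to 1 and every revival is perfect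
    state transfer. *)
Lemma proper_valuation : admits_proper_FR R (cayley S) -> (nu + 1 <= alpha)%N.
Proof.
move=> [t fr]; have nua : (nu <= alpha)%N.
  apply: FR_valuation; exists t; apply/fractional_revival_atE.
  by case/proper_revival_atE: fr.
rewrite addn1 ltn_neqAle nua andbT; apply/eqP => e.
case/proper_revival_atE: fr => _ w4 w1 wN1.
have : expi (2 * L%:R * t) ^+ 2 = 1.
  rewrite LE -expiMn [X in expi X](_ : _ = (4 * orth_gcd%:R * t) *+ k).
    by rewrite expiMn w4 expr1n.
  by rewrite gcdE e -[RHS]mulr_natl natrM; ring.
by move/eqP; rewrite sqrf_eq1 => /orP[/eqP|/eqP].
Qed.

Lemma balanced_valuation : (nu + 1 <= alpha)%N ->
  balanced_revival_at (cayley S) (pi / (2 ^ (nu + 2))%:R : R).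
Proof.
move=> h; apply: balanced_revival_at_phases => //.
- by rewrite divr_gt0// pi_gt0.
- by rewrite expi_gcd//; lia.
Qed.

Lemma valuation_proper : (nu + 1 <= alpha)%N -> admits_proper_FR R (cayley S).
Proof.
move=> h; exists (pi / (2 ^ (nu + 2))%:R); apply/proper_revival_atE.
split; rewrite ?divr_gt0 ?pi_gt0 ?expi_gcd//; first lia.
all: by move=> w; move: phase_quarter; rewrite w ?sqrrN expr1n => /esym/N1_neq1.
Qed.

(** The time is 2 pi / (4D), the least positive solution of exp(4iDt) = 1. *)
Lemma min_revival_valuation : (nu + 1 <= alpha)%N ->
  min_revival_time (cayley S) (2 * pi / (2 ^ (alpha + 2))%:R : R).
Proof.
move=> h.
have tE : 2 * pi / (2 ^ (alpha + 2))%:R = pi / (2 ^ (alpha + 1))%:R :> R.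
  by rewrite addn2 addn1 expnS natrM; field; rewrite lt0r_neq0.
rewrite tE; split.
  apply/fractional_revival_atE; split; rewrite ?divr_gt0 ?pi_gt0 ?expi_gcd// => w1.
  (* Raising the phase to the power [2 ^ (alpha - nu)] gives its value at [pi / 2 ^ (nu + 1)],
     namely -1, so it cannot be 1 itself. *)
  apply: N1_neq1; rewrite -phase_half.
  rewrite (_ : _ * _ = (2 * L%:R * (pi / (2 ^ (alpha + 1))%:R)) *+ 2 ^ (alpha - nu)).
    by rewrite expiMn w1 expr1n.
  have -> : (2 ^ (alpha + 1) = 2 ^ (alpha - nu) * 2 ^ (nu + 1))%N.
    by rewrite -expnD; congr expn; lia.
  rewrite -[RHS]mulr_natl natrM.
  by field; rewrite !lt0r_neq0.
move=> t /fractional_revival_atE[t0 w4 _].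
have := expi_eq1_ge _ w4; rewrite gcdE => /(_ _)/wrap[].
  by rewrite mulr_gt0// mulr_gt0.
by rewrite addn1 expnS natrM ler_pdivrMr ?mulr_gt0//; lra.
Qed.

Lemma valuation_dichotomy :
  [/\ ((alpha + 1 <= nu)%N <-> ~ admits_PST R (cayley S) /\ ~ admits_FR R (cayley S)),
      ((nu <= alpha)%N <-> admits_PST R (cayley S)),
      (alpha = nu -> admits_PST R (cayley S) /\ ~ admits_proper_FR R (cayley S)),
      ((nu + 1 <= alpha)%N <-> admits_proper_FR R (cayley S)) &
      ((nu + 1 <= alpha)%N ->
         min_revival_time (cayley S) (2 * pi / (2 ^ (alpha + 2))%:R : R) /\
         balanced_revival_at (cayley S) (pi / (2 ^ (nu + 2))%:R : R))].
Proof.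
have PST_FR : admits_PST R (cayley S) -> admits_FR R (cayley S).
  move=> [t [t0 [u [v [a [b [uv _]]]]]]]; exists t; split=> //.
  by exists u, v, a, b.
split.
- split=> [h|[nP nF]].
    suff nF : ~ admits_FR R (cayley S) by split=> // /PST_FR.
    by move=> /FR_valuation; lia.
  by rewrite addn1 ltnNge; apply/negP => /PST_valuation.
- by split=> [|/PST_FR]; [exact: PST_valuation|exact: FR_valuation].
- by move=> e; split=> [|/proper_valuation]; [apply: PST_valuation; rewrite e|lia].
- by split; [exact: valuation_proper|exact: proper_valuation].
- by move=> h; split; [exact: min_revival_valuation|exact: balanced_valuation].
Qed.

End Spectrum.
End CentralExtension.

(** * Extraspecial groups as central extensions of elementary abelian groups *)

Unset Implicit Arguments.
Set Strict Implicit.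

Theorem theorem5p1
  (R : realType) (gT : finGroupType) (n : nat)
  (hG2 : (2.-group [set: gT])%g)
  (hG : extraspecial [set: gT])
  (hn : (1 <= n)%N)
  (hcard : #|[set: gT]| = (2 ^ (2 * n + 1))%N)
  (z : gT) (hz : 'Z([set: gT])%g = [set 1%g; z])
  (f : {morphism ([set: gT] / 'Z([set: gT]))%g >-> 'rV['F_2]_(2 * n)})
  (hf : isom ([set: gT] / 'Z([set: gT]))%g [set: 'rV['F_2]_(2 * n)] f)
  (S : {set gT}) (hS : admissible S)
  (l : nat) (x : 'I_l -> gT)
  (hx2 : forall i : 'I_l, #|(x i ^: [set: gT])%g| = 2%N)
  (hxinj : injective (fun i : 'I_l => (x i ^: [set: gT])%g))
  (hx : S :\ z = (\bigcup_(i < l) (x i ^: [set: gT])%g)%SET)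
  (e : 'rV['F_2]_(2 * n) -> nat)
  (he : forall y : 'rV['F_2]_(2 * n),
     e y = count_orth (fun i : 'I_l => f (coset 'Z([set: gT])%g (x i))) y)
  (alpha g h : nat)
  (halpha : alpha
     = logn 2 (\big[gcdn/0%N]_(y : 'rV['F_2]_(2 * n)) (l - e y)%N))
  (hg : g = if z \in S
            then minn (2 ^ logn 2 (2 * l + 2)) (2 ^ (alpha + 2))
            else minn (2 ^ logn 2 (2 * l)) (2 ^ (alpha + 2)))
  (hh : (h * g)%N = (2 ^ (alpha + 2))%N) :
  (z \in S ->
     [/\ ((alpha + 1 <= logn 2 (l + 1))%N <->
            ~ admits_PST R (cayley S) /\ ~ admits_FR R (cayley S)),
         ((alpha >= logn 2 (l + 1))%N <-> admits_PST R (cayley S)),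
         (alpha = logn 2 (l + 1) ->
            admits_PST R (cayley S) /\ ~ admits_proper_FR R (cayley S)),
         ((alpha >= logn 2 (l + 1) + 1)%N <-> admits_proper_FR R (cayley S)) &
         ((alpha >= logn 2 (l + 1) + 1)%N ->
            min_revival_time (cayley S) (2 * pi / (h * g)%:R : R) /\
            balanced_revival_at (cayley S) (pi / (2 * g)%:R : R))])
  /\
  (z \notin S ->
     [/\ ((alpha + 1 <= logn 2 l)%N <->
            ~ admits_PST R (cayley S) /\ ~ admits_FR R (cayley S)),
         ((alpha >= logn 2 l)%N <-> admits_PST R (cayley S)),
         (alpha = logn 2 l ->
            admits_PST R (cayley S) /\ ~ admits_proper_FR R (cayley S)),
         ((alpha >= logn 2 l + 1)%N <-> admits_proper_FR R (cayley S)) &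
         ((alpha >= logn 2 l + 1)%N ->
            min_revival_time (cayley S) (2 * pi / (h * g)%:R : R) /\
            balanced_revival_at (cayley S) (pi / (2 * g)%:R : R))]).
Proof.
have Gn : ([set: gT] \subset 'N('Z([set: gT])))%g by exact: gFnorm.
have inN (a : gT) : (a \in 'N('Z([set: gT])))%g by apply: (fintype.subsetP Gn); rewrite inE.
pose F (a : gT) := f (coset 'Z([set: gT])%g a).
have [fM finj fim] : [/\ {in ([set: gT] / 'Z([set: gT]))%g &, {morph f : a b / (a * b)%g}},
    'injm f & f @* ([set: gT] / 'Z([set: gT])) = [set: 'rV['F_2]_(2 * n)]]%g.
  by split; [exact: morphM|exact: (isom_inj hf)|exact: (isom_im hf)].
have FinQ a : coset 'Z([set: gT])%g a \in ([set: gT] / 'Z([set: gT]))%g.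
  by rewrite mem_quotient ?inE.
have FM a b : F (a * b)%g = F a + F b.
  by rewrite /F morphM ?inN//; have -> := fM _ _ (FinQ a) (FinQ b).
have Fker a : (F a == 0) = (a == 1%g) || (a == z).
  have -> : (a == 1%g) || (a == z) = (a \in 'Z([set: gT])%g) by rewrite hz !inE.
  have -> : (F a == 0) = (coset 'Z([set: gT])%g a == 1%g).
    by rewrite -(inj_in_eq (injmP finj) (FinQ a) (group1 _)) morph1.
  by apply/eqP/idP => [/coset_idr->//|/coset_id].
have Fsurj v : exists a, F a = v.
  have : v \in (f @* ([set: gT] / 'Z([set: gT])))%g by rewrite fim inE.
  case/morphimP => w _ /morphimP[a _ _ ->] ->; by exists a.
have z_neq1 : z != 1%g.
  by apply: contraTneq (hG.2) => z1; rewrite hz z1 finset.setUid cards1.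
have F1 : F 1%g = 0 by apply/eqP; rewrite Fker eqxx.
have Fconj a b : F (a ^ b)%g = F a.
  by rewrite conjgE !FM addrC -addrA -FM mulgV F1 addr0.
have classE i b : (b \in x i ^: [set: gT])%g = (F b == F (x i)).
  (* The class lies in the coset of the center because [F] is invariant under conjugation; both have
     two elements. *)
  have -> : (x i ^: [set: gT])%g = (x i *: 'Z([set: gT]))%g.
    have cZ : #|(x i *: 'Z([set: gT]))%g| = 2%N.
      by rewrite card_lcoset (congr1 (fun A : {set gT} => #|A|) hz) cards2 eq_sym z_neq1.
    apply/eqP; rewrite eqEcard hx2 cZ andbT.
    apply/fintype.subsetP => c /imsetP[d _ ->]; rewrite mem_lcoset hz !inE -Fker.
    by rewrite FM Fconj -FM mulVg F1.
  rewrite mem_lcoset hz !inE -Fker FM addrC.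
  have -> : F (x i)^-1%g = - F (x i) by apply: (addrI (F (x i))); rewrite -FM mulgV F1 subrr.
  by rewrite subr_eq0.
pose xb i := F (x i).
have xb_inj : injective xb.
  by move=> i j ij; apply: hxinj; apply/setP => b; rewrite !classE -/(xb i) ij.
have xb_neq0 i : xb i != 0.
  (* An element with trivial image is central, so its class would be a singleton. *)
  apply/eqP => xi0; have := hx2 i; have -> : (x i ^: [set: gT])%g = [set x i]%SET.
    apply/setP => b; rewrite inE; apply/imsetP/eqP => [[c _ ->]|->]; last first.
      by exists 1%g; rewrite ?inE ?conjg1.
    have : x i \in 'Z([set: gT])%g by rewrite hz !inE -Fker -/(xb i) xi0.
    case/centerP => _ /(_ c (finset.in_setT _))/commgP.
    by rewrite conjg_mulR => /eqP->; rewrite mulg1.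
  by rewrite cards1.
have SE a : (a \in S) = (z \in S) && (a == z) || [exists i, F a == xb i].
  have ex : [exists i, F a == xb i] = (a \in S :\ z).
    rewrite hx; apply/existsP/finset.bigcupP => [[i ai]|[i _ ai]]; exists i => //.
      by rewrite classE.
    by rewrite -classE.
  by rewrite ex !inE; case: eqP => [->|_]; rewrite ?andbT ?orbF ?andbF.
have l_gt0 : (0 < l)%N.
  case: (posnP l) => // l0.
  (* With no noncentral class, [S] would lie in the center, of order at most 2, yet generate a group
     of order [2 ^ (2 * n + 1)]. *)
  have Sz : S \subset 'Z([set: gT])%g.
    apply/fintype.subsetP => a; rewrite SE hz !inE => /orP[/andP[_ ->]|/existsP[[i il]]].
      by rewrite orbT.
    by have := il; rewrite {1}l0.
  have [_ _ genS _] := hS.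
  have : ([set: gT] \subset 'Z([set: gT]))%g by have := Sz; rewrite -gen_subG genS.
  move=> /subset_leq_card; rewrite hcard hz cards2 addn1 expnS.
  have : (1 < 2 ^ (2 * n))%N by rewrite -{1}(expn0 2) ltn_exp2l// muln_gt0.
  by case: (_ != _) => /=; lia.
have eE y : e y = count_orth xb y by rewrite he.
have alphaE : orth_gcd xb = (2 ^ alpha)%N.
  rewrite (orth_gcd_pow2 xb_inj xb_neq0 l_gt0) halpha.
  by congr (2 ^ logn 2 _)%N; apply: eq_bigr => y _; rewrite eE.
have L_gt0 : (0 < l + (z \in S))%N by rewrite addn_gt0 l_gt0.
have [k k2 Lk] := pfactor_coprime (isT : prime 2) L_gt0.
rewrite mulnC in Lk; rewrite coprime2n in k2.
have main := valuation_dichotomy FM Fker Fsurj z_neq1 R xb_inj xb_neq0 SE alphaE Lk k2.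
(* In this range the first term of the minimum is the smaller one, so [2 * g] is the denominator of
   the balanced revival time. *)
have gE : (logn 2 (l + (z \in S)) <= alpha)%N -> g = (2 ^ (logn 2 (l + (z \in S)) + 1))%N.
  move=> h1; have logn2 j : (0 < j)%N -> logn 2 (2 * j) = (logn 2 j + 1)%N.
    by move=> j0; rewrite lognM// addn1.
  have -> : g = minn (2 ^ logn 2 (2 * (l + (z \in S)))) (2 ^ (alpha + 2)).
    by rewrite hg; case: (z \in S); rewrite ?addn0 ?mulnDr.
  by rewrite logn2// (minn_idPl _)// leq_exp2l//; lia.
have pig : (logn 2 (l + (z \in S)) + 1 <= alpha)%N ->
    pi / (2 * g)%:R = pi / (2 ^ (logn 2 (l + (z \in S)) + 2))%:R :> R.
  by move=> h1; rewrite gE -?expnS ?addn1 ?addn2//; lia.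
split=> [zS|/negPf zS]; rewrite zS /= ?addn0 in main pig; case: main => m1 m2 m3 m4 m5.
all: split; [exact: m1|exact: m2|exact: m3|exact: m4|move=> h1].
all: by rewrite hh (pig h1); exact: m5 h1.
Qed.
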